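(* Let $n,\ell$ be positive integers. For $i=1,\ldots,\ell$, let $\mu_i$ be a positive integer, $k_i=\lfloor \mu_i(n-1)/2\rfloor$, and assume $\mu_iK_n$ admits a 2-factorization of type $\mathcal{T}_i=[T_{i,1},\ldots,T_{i,k_i}]$. Let $\mathcal{O}=\{i:\mu_i(n-1)\text{ is odd}\}$ and let $\mu$ be a positive integer. Then $\mu K_n$ admits a 2-factorization of type $$\bigsqcup_{i=1}^{\ell}[T_{i,1}^{\langle x_i\rangle},\ldots,T_{i,k_i}^{\langle x_i\rangle}]\ \sqcup\ [T_1,\ldots,T_{\lfloor\beta/2\rfloor}]$$ for all $(x_1,\ldots,x_\ell)\in\mathbb{N}^\ell$ with $\sum_{i=1}^\ell x_i\mu_i=\mu$, where $\beta=\sum_{i\in\mathcal{O}}x_i$, and for all admissible bipartite 2-factor types $T_1,\ldots,T_{\lfloor\beta/2\rfloor}$ for $2K_n$.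
   Context: $\mu K_n$: complete multigraph on $n$ vertices with $\mu$ parallel edges between each pair. A 2-factor is a spanning 2-regular subgraph (2-cycles, i.e. pairs of parallel edges, allowed); it has type $[c_1,\ldots,c_t]$ if it is a disjoint union of cycles of lengths $c_1,\ldots,c_t$. A 2-factorization of an $r$-regular graph is a decomposition into $\lfloor r/2\rfloor$ 2-factors, plus a single 1-factor if $r$ is odd; its type is the multiset of the types of its 2-factors. Multiset notation: $[x^{\langle a\rangle}]$ denotes $a$ copies of $x$; $\sqcup$ is multiset union (multiplicities add). A 2-factor type is bipartite if all cycle lengths are even; it is admissible for $\lambda K_n$ iff its entries sum to $n$, all are at least 2, and all are at least 3 when $\lambda=1$. *)

(* Defs.v *)
From mathcomp Require Export all_boot finmap multiset.

Set Implicit Arguments.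
Unset Strict Implicit.
Unset Printing Implicit Defensive.

Local Open Scope mset_scope.
Local Open Scope nat_scope.

(* A loopless multigraph with vertex set V as its multiset of edges: [G e] is the
   number of parallel copies of the edge e. The type does not force edges to be
   2-element sets, but the graphs used below are [complete_mgraph] and its
   submultisets, where they are. All subgraphs are spanning, since V is fixed. *)
Notation mgraph V := {mset {set V}}.

Section Multigraphs.

Variable V : finType.
Implicit Types (G F : mgraph V) (s : seq V) (T : {mset nat}).

Definition complete_mgraph (mu : nat) : mgraph V :=
  \big[msetD/mset0]_(e : {set V} | #|e| == 2) msetn mu e.

Definition degree G (v : V) : nat := \sum_(e <- G | v \in e) 1.

Definition regular (r : nat) G : Prop := forall v, degree G v = r.

Definition factor (k : nat) G F : Prop := F `<=` G /\ regular k F.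

Definition is_cycle s : bool := (1 < size s) && uniq s.

(* The cycle visiting the vertices of s in order and returning to the start;
   for size s = 2 this is a pair of parallel edges. *)
Definition cycle_mgraph s : mgraph V :=
  seq_mset [seq [set v; next s v] | v <- s].

(* F is a vertex-disjoint union of cycles whose lengths are the entries of T. *)
Definition has_type F T : Prop :=
  exists cs : seq (seq V),
    [/\ all is_cycle cs, uniq (flatten cs),
        F = \big[msetD/mset0]_(s <- cs) cycle_mgraph s &
        T = seq_mset [seq size s | s <- cs]].

(* The r-regular multigraph G admits a 2-factorization of type TT. The
   2-factors are an indexed family because a decomposition may use several
   2-factors with the same edge multiset (on different parallel edges). *)
Definition admits_2factorization (r : nat) G (TT : {mset {mset nat}}) : Prop :=
  regular r G /\
  exists (F : 'I_(r./2) -> mgraph V) (I : mgraph V)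
         (T : 'I_(r./2) -> {mset nat}),
    [/\ forall j, factor 2 G (F j) /\ has_type (F j) (T j),
        if odd r then factor 1 G I else I = mset0,
        G = (\big[msetD/mset0]_j F j) `+` I &
        TT = seq_mset [seq T j | j : 'I_(r./2)]].

End Multigraphs.

Definition complete_admits (mu n : nat) (TT : {mset {mset nat}}) : Prop :=
  admits_2factorization (mu * (n - 1)) (complete_mgraph 'I_n mu) TT.

Definition bipartite_type (T : {mset nat}) : Prop := forall c, c \in T -> ~~ odd c.

Definition admissible_type (lam n : nat) (T : {mset nat}) : Prop :=
  [/\ \sum_(c <- T) c = n,
      forall c, c \in T -> 2 <= c &
      lam = 1 -> forall c, c \in T -> 3 <= c].

(* Main.v *)
(* mu K_n is the sum of x_i copies of mu_i K_n over all i. A copy with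
   mu_i (n - 1) odd carries a leftover 1-factor, so there are beta of these.
   Any bipartite 2-factor splits into two 1-factors by taking alternate edges
   of its cycles, and any two 1-factors are equivalent under a vertex
   permutation, which fixes mu_i K_n and preserves 2-factor types. So permuting
   the vertices of each copy separately turns any two leftover 1-factors into a
   bipartite 2-factor of prescribed type; the beta leftovers are paired off. *)
Require Import Defs.
From HB Require Import structures.
From mathcomp Require Import all_boot finmap multiset.
From mathcomp Require Import perm.

Set Implicit Arguments.
Unset Strict Implicit.
Unset Printing Implicit Defensive.

Local Open Scope mset_scope.
Local Open Scope nat_scope.

(** * Multiset sums and multiplicities *)

HB.instance Definition _ (K : choiceType) :=
  Monoid.isComLaw.Build {mset K} mset0 msetD
    (@msetDA K) (@msetDC K) (@mset0D K).

Lemma uniq_flatten (T : eqType) (ss : seq (seq T)) s :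
  s \in ss -> uniq (flatten ss) -> uniq s.
Proof.
elim: ss => //= r ss IHss; rewrite inE cat_uniq.
by case/predU1P=> [-> /and3P[] //|s_ss /and3P[_ _]]; apply: IHss.
Qed.

Section MultisetSums.

Variable K : choiceType.
Implicit Types (A B : {mset K}) (s t : seq K).

Lemma perm_msetD A B : perm_eq (A `+` B) (A ++ B).
Proof.
by apply/allP => a _ /=; rewrite count_cat !count_mem_mset msetE2.
Qed.

Lemma seq_mset_cat s t : seq_mset (s ++ t) = seq_mset s `+` seq_mset t.
Proof. by apply/msetP => a; rewrite msetE2 !mset_seqE count_cat. Qed.

Lemma seq_mset_cons a s : seq_mset (a :: s) = a +` seq_mset s.
Proof. by apply/msetP => b; rewrite mset1DE !mset_seqE /= eq_sym. Qed.

Lemma seq_mset_nil : seq_mset [::] = mset0 :> {mset K}.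
Proof. by apply/msetP => a; rewrite mset_seqE mset0E. Qed.

Lemma seq_mset_map (I : Type) (r : seq I) (f : I -> K) :
  seq_mset (map f r) = \big[msetD/mset0]_(i <- r) [mset f i].
Proof.
elim: r => [|i r IHr]; first by rewrite big_nil seq_mset_nil.
by rewrite big_cons /= seq_mset_cons IHr.
Qed.

Lemma iter_msetD1 m (a : K) : iterop m msetD [mset a] mset0 = msetn m a.
Proof.
rewrite Monoid.iteropE; elim: m => [|m IHm] /=; first by rewrite msetn0.
by rewrite IHm; apply/msetP => b; rewrite msetE2 !msetnE; case: eqP.
Qed.

Lemma big_msetDE (I : Type) (r : seq I) (P : pred I) (F : I -> {mset K}) a :
  (\big[msetD/mset0]_(i <- r | P i) F i) a = \sum_(i <- r | P i) F i a.
Proof.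
by apply: (big_morph (fun A : {mset K} => A a)) => [A B|]; rewrite ?msetE2 ?mset0E.
Qed.

End MultisetSums.

(** * Degrees and complete multigraphs *)

Section Multigraphs.

Variable V : finType.
Implicit Types (G F M : mgraph V) (s t : seq V) (p : {perm V}) (v : V).

Lemma degreeD F G v : degree (F `+` G) v = degree F v + degree G v.
Proof. by rewrite /degree (perm_big _ (perm_msetD F G)) big_cat. Qed.

Lemma degree0 v : degree (mset0 : mgraph V) v = 0.
Proof. exact: big_mset0. Qed.

Lemma degree_seq_mset (es : seq {set V}) v :
  degree (seq_mset es) v = count (fun e : {set V} => v \in e) es.
Proof. by rewrite /degree (perm_big _ (perm_eq_seq_mset es)) sum1_count. Qed.

Lemma degree_big (I : Type) (r : seq I) (P : pred I) (F : I -> mgraph V) v :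
  degree (\big[msetD/mset0]_(i <- r | P i) F i) v =
  \sum_(i <- r | P i) degree (F i) v.
Proof.
by apply: (big_morph (fun G => degree G v)) => [A B|]; rewrite ?degreeD ?degree0.
Qed.

Lemma complete_mgraphE mu (e : {set V}) :
  complete_mgraph V mu e = if #|e| == 2 then mu else 0.
Proof.
rewrite /complete_mgraph big_msetDE; case: ifPn => [e2|ne2].
  rewrite (bigD1 e) //= msetnxx big1 ?addn0 // => f /andP[_ nfe].
  by rewrite msetnE eq_sym (negPf nfe).
rewrite big1 // => f f2; rewrite msetnE; case: eqP => // ef.
by rewrite ef f2 in ne2.
Qed.

Lemma complete_mgraphD a b :
  complete_mgraph V (a + b) = complete_mgraph V a `+` complete_mgraph V b.
Proof. by apply/msetP => e; rewrite msetE2 !complete_mgraphE; case: ifP. Qed.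

Lemma complete_mgraph0 : complete_mgraph V 0 = mset0.
Proof. by apply/msetP => e; rewrite mset0E complete_mgraphE if_same. Qed.

(** The degree in [complete_mgraph V 1] is left uncomputed: [theorem5p3] reads it off from the
    regularity of a given factorization. *)
Lemma degree_complete_mgraph mu v :
  degree (complete_mgraph V mu) v = mu * degree (complete_mgraph V 1) v.
Proof.
elim: mu => [|mu IHmu]; first by rewrite complete_mgraph0 degree0.
by rewrite -addn1 complete_mgraphD degreeD IHmu mulnDl mul1n.
Qed.

(** * Relabelling the vertices *)

Definition relabel p G : mgraph V := seq_mset [seq p @: e | e : {set V} <- G].

Lemma relabel_seq_mset p (es : seq {set V}) :
  relabel p (seq_mset es) = seq_mset [seq p @: e | e : {set V} <- es].
Proof. by apply/eq_seq_msetP/perm_map/perm_eq_seq_mset. Qed.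

Lemma relabelD p F G : relabel p (F `+` G) = relabel p F `+` relabel p G.
Proof.
rewrite /relabel -seq_mset_cat -map_cat; apply/eq_seq_msetP/perm_map.
exact: perm_msetD.
Qed.

Lemma relabel0 p : relabel p mset0 = mset0.
Proof. by rewrite /relabel enum_mset0 seq_mset_nil. Qed.

Lemma relabel_big p (I : Type) (r : seq I) (P : pred I) (F : I -> mgraph V) :
  relabel p (\big[msetD/mset0]_(i <- r | P i) F i) =
  \big[msetD/mset0]_(i <- r | P i) relabel p (F i).
Proof. by apply: (big_morph (relabel p)) => [A B|]; rewrite ?relabelD ?relabel0. Qed.

(** A permutation acts injectively on edges, so distinct edges never merge. *)
Lemma relabel_imset p G (e : {set V}) : relabel p G (p @: e) = G e.
Proof.
rewrite /relabel mset_seqE count_map -count_mem_mset; apply: eq_count => f /=.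
by rewrite (inj_eq (imset_inj (@perm_inj _ p))).
Qed.

Lemma imset_permKV p (e : {set V}) : p @: (p^-1%g @: e) = e.
Proof.
by rewrite -imset_comp -[RHS]imset_id; apply: eq_imset => v /=; rewrite permKV.
Qed.

Lemma relabel_complete p mu :
  relabel p (complete_mgraph V mu) = complete_mgraph V mu.
Proof.
apply/msetP => e; rewrite -(imset_permKV p e) relabel_imset !complete_mgraphE.
by rewrite (card_imset _ (@perm_inj _ p)).
Qed.

Lemma degree_relabel p G v : degree (relabel p G) (p v) = degree G v.
Proof.
rewrite degree_seq_mset count_map /degree sum1_count.
by apply: eq_count => e /=; rewrite mem_imset //; apply: perm_inj.
Qed.

Lemma regular_relabel p r G : regular r G -> regular r (relabel p G).
Proof. by move=> rG v; rewrite -(permKV p v) degree_relabel. Qed.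

Lemma relabel_cycle p s :
  uniq s -> relabel p (cycle_mgraph s) = cycle_mgraph (map p s).
Proof.
move=> us; rewrite relabel_seq_mset /cycle_mgraph -!map_comp; congr seq_mset.
apply: eq_map => v /=; rewrite (next_map (@perm_inj _ p)) //.
by rewrite imsetU1 imset_set1.
Qed.

Lemma has_type_relabel p F T : has_type F T -> has_type (relabel p F) T.
Proof.
case=> cs [ccs ucs -> ->]; exists (map (map p) cs); split.
- rewrite all_map; apply: sub_all ccs => s /andP[s2 us].
  by rewrite /= /is_cycle size_map s2 map_inj_uniq //; apply: perm_inj.
- by rewrite -map_flatten map_inj_uniq //; apply: perm_inj.
- rewrite relabel_big big_map; apply: eq_big_seq => s s_cs.
  by apply: relabel_cycle; have /andP[] := allP ccs s s_cs.
- by congr seq_mset; rewrite -map_comp; apply: eq_map => s /=; rewrite size_map.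
Qed.

(** * Perfect matchings as vertex sequences *)

(** A matching is encoded by listing the ends of its edges consecutively, so that relabelling it
    amounts to mapping a sequence. An unpaired last vertex is dropped, hence the parity conditions
    below. *)
Fixpoint pairs s : mgraph V :=
  if s is a :: b :: s' then [set a; b] +` pairs s' else mset0.

Lemma pairs_cat s t :
  ~~ odd (size s) -> pairs (s ++ t) = pairs s `+` pairs t.
Proof.
(* Strong induction on the size, since [pairs] consumes two vertices at a time. *)
elim/ltn_ind: {s}(size s) {-2}s (erefl (size s)) => m IHm [|a [|b s]] //= Em ods.
  by rewrite mset0D.
by rewrite (IHm (size s)) -?msetDA -?Em // -[odd _]negbK.
Qed.

Lemma pairs_flatten (cs : seq (seq V)) :
  all (fun s => ~~ odd (size s)) cs ->
  pairs (flatten cs) = \big[msetD/mset0]_(s <- cs) pairs s.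
Proof.
elim: cs => [|s cs IHcs] /=; first by rewrite big_nil.
by case/andP=> os ocs; rewrite pairs_cat // big_cons IHcs.
Qed.

Lemma relabel_pairs p s : relabel p (pairs s) = pairs (map p s).
Proof.
elim/ltn_ind: {s}(size s) {-2}s (erefl (size s)) => m IHm [|a [|b s]] /= Em.
- exact: relabel0.
- exact: relabel0.
rewrite relabelD (IHm (size s)) -?Em //; congr (_ `+` _).
rewrite -[in LHS](seq_mset_id [mset [set a; b]]) enum_msetn relabel_seq_mset /=.
by rewrite imsetU1 imset_set1 seq_mset_cons seq_mset_nil msetD0.
Qed.

Lemma degree_pairs s v :
  ~~ odd (size s) -> uniq s -> degree (pairs s) v = count_mem v s.
Proof.
elim/ltn_ind: {s}(size s) {-2}s (erefl (size s)) => m IHm [|a [|b s]] //= Em.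
  by rewrite degree0.
rewrite negbK inE => os /and3P[/norP[nab _] _ us].
rewrite degreeD (IHm (size s)) -?Em // addnA; congr addn.
rewrite -[[mset _]]seq_mset_id degree_seq_mset enum_msetn /= !inE addn0.
rewrite (eq_sym a) (eq_sym b); case: (eqVneq v a) => // ->.
by rewrite (negPf nab).
Qed.

Lemma regular_pairs s :
  ~~ odd #|V| -> perm_eq s (enum V) -> regular 1 (pairs s).
Proof.
move=> oV sV v; rewrite degree_pairs ?(perm_size sV) ?(perm_uniq sV) -?cardE //.
  by rewrite (seq.permP sV) count_uniq_mem ?enum_uniq // mem_enum.
exact: enum_uniq.
Qed.

(** Concatenate the two ends of every edge. Edges may share vertices, so [s] can have repetitions;
    its counts record the degrees. *)
Lemma pairs_of_edges (es : seq {set V}) :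
  {in es, forall e : {set V}, #|e| = 2} ->
  exists s, [/\ ~~ odd (size s), seq_mset es = pairs s &
    forall v, count_mem v s = count (fun e : {set V} => v \in e) es].
Proof.
elim: es => [|e es IHes] es2; first by exists [::]; split; rewrite ?seq_mset_nil.
have [|s [os Es cs]] := IHes; first by move=> f fes; rewrite es2 // inE fes orbT.
have /eqP/cards2P[a [b [nab Ee]]] := es2 e (mem_head e es).
exists [:: a, b & s]; split; rewrite /= ?negbK //.
  by rewrite seq_mset_cons Es Ee.
move=> v; rewrite cs addnA; congr addn.
rewrite Ee !inE (eq_sym a) (eq_sym b); case: (eqVneq v a) => // ->.
by rewrite (negPf nab).
Qed.

(** Edges are arbitrary sets, so degree 1 alone does not make them pairs; the second clause does. *)
Definition one_factor M : Prop :=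
  regular 1 M /\ {in M, forall e : {set V}, #|e| = 2}.

(** In the list of edge ends each vertex occurs as often as its degree, that is once. So the list
    enumerates [V], and its even length gives the parity of [#|V|]. *)
Lemma one_factor_pairs M :
  one_factor M ->
  exists s, [/\ ~~ odd #|V|, perm_eq s (enum V) & M = pairs s].
Proof.
case=> rM M2; have [s [os Es cs]] := pairs_of_edges M2.
have sV : perm_eq s (enum V).
  apply/allP => v _ /=; rewrite cs -sum1_count [X in X == _]rM.
  by rewrite count_uniq_mem ?enum_uniq // mem_enum.
by exists s; rewrite -Es seq_mset_id cardE -(perm_size sV).
Qed.

Lemma one_factor_sub mu M :
  factor 1 (complete_mgraph V mu) M -> one_factor M.
Proof.
case=> /msubset_subset MK rM; split=> // e /MK.
by rewrite in_mset complete_mgraphE; case: eqP.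
Qed.

(** Send each entry of [s] to the entry of [t] at the same position. This makes any two perfect
    matchings equivalent under relabelling. *)
Lemma perm_enum_perm s t :
  perm_eq s (enum V) -> perm_eq t (enum V) -> exists p, map p s = t.
Proof.
move=> sV tV.
have us : uniq s by rewrite (perm_uniq sV) enum_uniq.
have ut : uniq t by rewrite (perm_uniq tV) enum_uniq.
have st : size s = size t by rewrite (perm_size sV) (perm_size tV).
have ins v : index v s < size t.
  by rewrite -st index_mem (perm_mem sV) mem_enum.
(* The default [v] is never reached, by [ins]. *)
pose f v := nth v t (index v s).
have f_inj : injective f.
  move=> v w; rewrite /f (set_nth_default v w) // => /eqP.
  rewrite nth_uniq // => /eqP Evw; rewrite -(nth_index v (_ : v \in s)).
    by rewrite Evw nth_index // (perm_mem sV) mem_enum.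
  by rewrite (perm_mem sV) mem_enum.
exists (perm f_inj); rewrite (eq_map (permE f_inj)) /f.
case: (s) us st => [|a r] ur rt; first by case: (t) rt.
apply: (@eq_from_nth _ a) => [|i]; first by rewrite size_map.
rewrite size_map => lti; rewrite (nth_map a) // index_uniq //.
by apply: set_nth_default; rewrite -rt.
Qed.

(** * Even cycles and bipartite 2-factors *)

(** Unrolls the cycle into a walk from [x] back to [x], a form open to induction. *)
Lemma cycle_mgraph_pairmap x s : uniq (x :: s) ->
  cycle_mgraph (x :: s) =
  seq_mset (pairmap (fun a b => [set a; b]) x (rcons s x)).
Proof.
move=> us; congr seq_mset; apply: (@eq_from_nth _ set0).
  by rewrite size_map size_pairmap size_rcons.
move=> i; rewrite size_map => lti.
rewrite (nth_map x) // (nth_pairmap x) ?size_rcons // next_nth mem_nth //.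
rewrite index_uniq // nth_rcons -rcons_cons nth_rcons lti.
(* On the closing edge, [next] reads past the end of [s] and gets the default [x], the start of the
   cycle. *)
by case: ltnP => // /(nth_default x) ->; rewrite if_same.
Qed.

(** The walk [x], [s], [z] has an even number of edges. Its first, third, ... edges are
    [pairs (x :: s)], the others [pairs (rcons s z)]. *)
Lemma pairmap_pairs x z s : odd (size s) ->
  seq_mset (pairmap (fun a b => [set a; b]) x (rcons s z)) =
  pairs (x :: s) `+` pairs (rcons s z).
Proof.
elim/ltn_ind: {s}(size s) x {-2}s (erefl (size s)) => m IHm x [|y [|w s]] //= Em.
  by rewrite !seq_mset_cons seq_mset_nil !msetD0.
rewrite negbK => os; rewrite !seq_mset_cons (IHm (size s)) -?Em //=.
by rewrite -!msetDA; congr (_ `+` _); rewrite msetDCA.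
Qed.

(* The alternate edges of an even cycle form two perfect matchings of its vertices. *)
Lemma even_cycle_pairs s : ~~ odd (size s) -> uniq s ->
  cycle_mgraph s = pairs s `+` pairs (rot 1 s).
Proof.
case: s => [|x s] os us; first by rewrite /cycle_mgraph seq_mset_nil msetD0.
rewrite cycle_mgraph_pairmap // pairmap_pairs; last by rewrite -[odd _]negbK.
by rewrite rot1_cons.
Qed.

(** Cut the enumeration of [V] into consecutive blocks whose sizes are the entries of [T], and close
    each block into a cycle. Blocks have even size, so no pair straddles two of them and the
    matchings of the cycles assemble. *)
Lemma bipartite_2factor (T : {mset nat}) :
  admissible_type 2 #|V| T -> bipartite_type T -> ~~ odd #|V| ->
  exists F s t, [/\ has_type F T, regular 2 F, perm_eq s (enum V),
    perm_eq t (enum V) & F = pairs s `+` pairs t].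
Proof.
case=> sumT T2 _ evT oV.
pose cs := reshape (T : seq nat) (enum V).
have sT : sumn T = size (enum V) by rewrite -cardE -sumT sumnE.
have shcs : shape cs = T :> seq nat by rewrite reshapeKl // sT.
have flcs : flatten cs = enum V by rewrite reshapeKr // sT.
have ucs c : c \in cs -> uniq c.
  by move=> c_cs; apply: (uniq_flatten c_cs); rewrite flcs enum_uniq.
have cs_T c : c \in cs -> size c \in T.
  by move=> c_cs; rewrite -[size c \in T]/(size c \in (T : seq nat)) -shcs map_f.
have ecs : all (fun c => ~~ odd (size c)) cs.
  by apply/allP => c /cs_T /evT.
pose F := \big[msetD/mset0]_(c <- cs) cycle_mgraph c.
(* Rotating each block by one selects the other alternate edges of its cycle. *)
pose t := flatten (map (rot 1) cs).
have tV : perm_eq t (enum V).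
  rewrite -flcs /t; elim: (cs) => //= c r IHr.
  by apply: perm_cat => //; rewrite perm_rot.
have FE : F = pairs (enum V) `+` pairs t.
  rewrite -[X in pairs X `+` _]flcs /t !pairs_flatten //.
    rewrite big_map -big_split; apply: eq_big_seq => c c_cs.
    by rewrite even_cycle_pairs ?ucs // (allP ecs).
  by rewrite all_map; apply: sub_all ecs => c /=; rewrite size_rot.
exists F, (enum V), t; split=> //.
  exists cs; split=> //; last by rewrite -/(shape cs) shcs seq_mset_id.
    by apply/allP => c c_cs; rewrite /is_cycle ucs // T2 // cs_T.
  by rewrite flcs enum_uniq.
by move=> v; rewrite FE degreeD !regular_pairs.
Qed.
Definition decomposes G (TT : {mset {mset nat}}) M : Prop :=
  exists Fs : seq (mgraph V * {mset nat}),
    [/\ {in Fs, forall FT, regular 2 FT.1 /\ has_type FT.1 FT.2},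
        G = (\big[msetD/mset0]_(FT <- Fs) FT.1) `+` M &
        TT = seq_mset [seq FT.2 | FT <- Fs]].

Lemma decomposesD G TT M G' TT' M' :
  decomposes G TT M -> decomposes G' TT' M' ->
  decomposes (G `+` G') (TT `+` TT') (M `+` M').
Proof.
move=> [Fs [FsP -> ->]] [Fs' [FsP' -> ->]]; exists (Fs ++ Fs'); split.
- by move=> FT; rewrite mem_cat => /orP[/FsP|/FsP'].
- by rewrite big_cat /= -!msetDA; congr (_ `+` _); rewrite msetDCA.
- by rewrite map_cat seq_mset_cat.
Qed.

Lemma decomposes0 : decomposes mset0 mset0 mset0.
Proof. by exists [::]; split; rewrite ?big_nil ?msetD0 ?seq_mset_nil. Qed.

Lemma decomposes1 F T :
  regular 2 F -> has_type F T -> decomposes F [mset T] mset0.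
Proof.
move=> rF FT; exists [:: (F, T)]; split=> [FT'|//|/=].
- by rewrite inE => /eqP->.
- by rewrite big_seq1 msetD0.
- by rewrite seq_mset_cons seq_mset_nil msetD0.
Qed.

Lemma decomposes_absorb G TT M F TT' M' :
  decomposes G TT (F `+` M) -> decomposes F TT' M' ->
  decomposes G (TT `+` TT') (M' `+` M).
Proof.
move=> [Fs [FsP -> ->]] [Fs' [FsP' -> ->]]; exists (Fs ++ Fs'); split.
- by move=> FT; rewrite mem_cat => /orP[/FsP|/FsP'].
- by rewrite big_cat /= -!msetDA.
- by rewrite map_cat seq_mset_cat.
Qed.

Lemma decomposes_relabel p G TT M :
  decomposes G TT M -> decomposes (relabel p G) TT (relabel p M).
Proof.
move=> [Fs [FsP -> ->]].
exists [seq (relabel p FT.1, FT.2) | FT <- Fs]; split.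
- move=> _ /mapP[FT /FsP[rFT tFT] ->] /=.
  by split; [apply: regular_relabel | apply: has_type_relabel].
- by rewrite relabelD relabel_big big_map.
- by rewrite -map_comp.
Qed.

(** Only the parity of [r] matters: it is a degree in some uses and a number of odd copies in
    others. *)
Definition leftover (r : nat) M : Prop :=
  if odd r then one_factor M else M = mset0.

(* Relabelling the two copies turns their 1-factors into the two perfect
   matchings whose union is a 2-factor of type T. *)
Lemma decomposes_pair a b TT TT' M M' (T : {mset nat}) :
  decomposes (complete_mgraph V a) TT M -> one_factor M ->
  decomposes (complete_mgraph V b) TT' M' -> one_factor M' ->
  admissible_type 2 #|V| T -> bipartite_type T ->
  decomposes (complete_mgraph V (a + b)) ((TT `+` TT') `+` [mset T]) mset0.
Proof.
move=> dM /one_factor_pairs[u [oV uV Mu]] dM' /one_factor_pairs[u' [_ uV' Mu']].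
move=> admT bipT.
have [F [s [t [tF rF sV tV Fst]]]] := bipartite_2factor admT bipT oV.
have [p pu] := perm_enum_perm uV sV; have [q qu] := perm_enum_perm uV' tV.
have := decomposesD (decomposes_relabel p dM) (decomposes_relabel q dM').
rewrite !relabel_complete -complete_mgraphD Mu Mu' !relabel_pairs pu qu -Fst.
(* The added [mset0] terms give the leftovers the sum shape of [decomposes_absorb]; the whole
   leftover [F] becomes a factor. *)
rewrite -[F]msetD0 => dF; rewrite -[X in decomposes _ _ X]msetD0.
by apply: decomposes_absorb dF (decomposes1 rF tF).
Qed.

(** Induction on the list of copies with at most one 1-factor pending: an odd copy either leaves its
    1-factor pending or pairs it with the pending one, using up one type of [Us]. *)
Lemma decomposes_copies (I : eqType) (m r : I -> nat)
    (TT : I -> {mset {mset nat}}) (js : seq I) (Us : seq {mset nat}) :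
  {in js, forall i, exists M,
     decomposes (complete_mgraph V (m i)) (TT i) M /\ leftover (r i) M} ->
  size Us = (count (fun i => odd (r i)) js)./2 ->
  {in Us, forall T, admissible_type 2 #|V| T /\ bipartite_type T} ->
  exists M, decomposes (complete_mgraph V (\sum_(i <- js) m i))
      ((\big[msetD/mset0]_(i <- js) TT i) `+` seq_mset Us) M /\
    leftover (count (fun i => odd (r i)) js) M.
Proof.
rewrite /leftover; elim: js Us => [|i js IHjs] Us jsP sUs UsP.
  exists mset0; rewrite !big_nil complete_mgraph0 (size0nil sUs) seq_mset_nil.
  by rewrite msetD0; split=> //; apply: decomposes0.
have [M [dM lM]] := jsP i (mem_head i js).
have {}jsP : {in js, forall i, exists M,
    decomposes (complete_mgraph V (m i)) (TT i) M /\ leftover (r i) M}.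
  by move=> j j_js; apply: jsP; rewrite inE j_js orbT.
rewrite !big_cons complete_mgraphD -!msetDA /=.
move: sUs lM => /=; rewrite /leftover; case: ifP => /= ori sUs lM; last first.
  have [M' [dM' lM']] := IHjs Us jsP sUs UsP.
  exists M'; rewrite add0n; split=> //.
  by rewrite -[M']mset0D -lM; apply: decomposesD.
move: sUs IHjs; rewrite add0n uphalf_half.
(* If the tail has an even number of odd copies, it leaves nothing and [M] stays pending. Otherwise
   [M] is paired with the 1-factor of the tail. *)
case: odd => /= sUs IHjs; last first.
  have [M' [dM' lM']] := IHjs Us jsP sUs UsP.
  by exists M; split=> //; rewrite -[M]msetD0 -lM'; apply: decomposesD.
case: Us UsP sUs => [|T Us] //= UsP [sUs].
have [|M' [dM' lM']] := IHjs Us jsP sUs.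
  by move=> T' T'Us; apply: UsP; rewrite inE T'Us orbT.
have [admT bipT] := UsP T (mem_head T Us).
exists mset0; split=> //.
have := decomposes_pair dM lM dM' lM' admT bipT.
by rewrite complete_mgraphD seq_mset_cons -!msetDA [[mset T] `+` _]msetDC.
Qed.

(** * Passing to and from 2-factorizations *)

Lemma decomposes_of_admits mu r TT :
  admits_2factorization r (complete_mgraph V mu) TT ->
  exists M, decomposes (complete_mgraph V mu) TT M /\ leftover r M.
Proof.
case=> _ [F [M [T [FP MP GE ->]]]]; exists M; split; last first.
  by move: MP; rewrite /leftover; case: ifP => // _ /one_factor_sub.
exists [seq (F j, T j) | j : 'I_(r./2)]; split.
- by move=> _ /mapP[j _ ->] /=; have [[]] := FP j.
- by rewrite GE big_map big_enum.
- by rewrite -map_comp.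
Qed.

(** The degree at [v] forces the number of factors: [r] is twice [size Fs] plus the parity of [r]. A
    vertex is taken as argument because on an empty [V] degrees determine nothing. *)
Lemma admits_of_decomposes r G TT M v :
  regular r G -> decomposes G TT M -> leftover r M ->
  admits_2factorization r G TT.
Proof.
move=> rG [Fs [FsP GE TTE]] lM; split=> //.
have degM w : degree M w = odd r.
  by move: lM; rewrite /leftover; case: odd => [[]//|->]; rewrite degree0.
have sFs : r./2 = size Fs.
  rewrite -(rG v) GE degreeD degree_big degM (eq_big_seq (fun=> 2)); last first.
    by move=> FT /FsP[].
  rewrite big_const_seq count_predT iter_addn addn0 mul2n addnC.
  exact: half_bit_double.
rewrite sFs.
exists (fun j => (tnth (in_tuple Fs) j).1), M, (fun j => (tnth (in_tuple Fs) j).2).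
have sumE : G = (\big[msetD/mset0]_(j < size Fs) (tnth (in_tuple Fs) j).1) `+` M.
  by rewrite GE [in LHS](big_tnth _ _ Fs).
split=> //.
- move=> j; have [rFj tFj] := FsP _ (mem_tnth j (in_tuple Fs)).
  split=> //; split=> //; apply/msubsetP => e.
  by rewrite sumE msetE2 big_msetDE (bigD1 j) //= -addnA leq_addr.
- move: lM; rewrite /leftover; case: odd => // -[rM _]; split=> //.
  by apply/msubsetP => e; rewrite GE msetE2 leq_addl.
- by rewrite TTE /image_mem (map_comp snd (tnth (in_tuple Fs))) map_tnth_enum.
Qed.

End Multigraphs.

(** * Copies, multiplicities and the final assembly *)

(** Stated for any commutative law, to serve the sums of numbers and of multisets over the list of
    copies alike. *)
Lemma big_copies (R : Type) (idx : R) (op : Monoid.com_law idx) (I : finType)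
    (x : I -> nat) (P : pred I) (F : I -> R) :
  \big[op/idx]_(i <- flatten [seq nseq (x i) i | i : I] | P i) F i =
  \big[op/idx]_(i | P i) iterop (x i) op (F i) idx.
Proof.
rewrite big_flatten big_map big_enum /= [RHS]big_mkcond; apply: eq_bigr => i _.
by rewrite big_nseq_cond -Monoid.iteropE.
Qed.

Lemma iterop_addn m a : iterop m addn a 0 = m * a.
Proof. by rewrite Monoid.iteropE iter_addn_0 mulnC. Qed.

(** Trades repetition of a whole list of types for a multiplicity on each type, the form used in
    [theorem5p3]. *)
Lemma iterop_big_mset (K : choiceType) (I : finType) (f : I -> K) m :
  iterop m msetD (seq_mset [seq f i | i : I]) mset0 =
  \big[msetD/mset0]_i msetn m (f i).
Proof.
rewrite seq_mset_map big_enum; under [RHS]eq_bigr do rewrite -iter_msetD1.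
rewrite Monoid.iteropE.
under [RHS]eq_bigr do rewrite Monoid.iteropE.
elim: m => [|m IHm] /=; first by rewrite big1.
by rewrite IHm -big_split.
Qed.

Theorem theorem5p3 (n l : nat) (n_gt0 : 0 < n) (l_gt0 : 0 < l)
    (mu_ : 'I_l -> nat) (mu_gt0_ : forall i, 0 < mu_ i)
    (k : 'I_l -> nat) (kE : forall i, k i = (mu_ i * (n - 1))./2)
    (T : forall i : 'I_l, 'I_(k i) -> {mset nat})
    (hT : forall i, complete_admits (mu_ i) n (seq_mset [seq T i j | j : 'I_(k i)]))
    (mu : nat) (mu_gt0 : 0 < mu)
    (x : 'I_l -> nat) (hx : \sum_(i < l) x i * mu_ i = mu)
    (beta : nat) (betaE : beta = \sum_(i < l | odd (mu_ i * (n - 1))) x i)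
    (U : 'I_(beta./2) -> {mset nat})
    (U_admissible : forall j, admissible_type 2 n (U j))
    (U_bipartite : forall j, bipartite_type (U j)) :
  complete_admits mu n
    ((\big[msetD/mset0]_(i < l) \big[msetD/mset0]_(j < k i) msetn (x i) (T i j))
       `+` seq_mset [seq U j | j : 'I_(beta./2)]).
Proof.
pose r i := mu_ i * (n - 1).
pose copies := flatten [seq nseq (x i) i | i : 'I_l].
have count_beta : count (fun i => odd (r i)) copies = beta.
  rewrite -sum1_count big_copies betaE; apply: eq_bigr => i _.
  by rewrite iterop_addn muln1.
(* The given factorization for the first index has a regular graph; cancelling its positive
   multiplicity leaves degree [n - 1] for the simple complete graph. *)
have reg : regular (mu * (n - 1)) (complete_mgraph 'I_n mu).
  move=> v; rewrite degree_complete_mgraph; congr muln.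
  have [/(_ v) + _] := hT (Ordinal l_gt0); rewrite degree_complete_mgraph.
  by move/eqP; rewrite eqn_pmul2l // => /eqP.
(* Modulo 2, only the indices with [mu_ i * (n - 1)] odd contribute to the sum of the
   [x i * mu_ i * (n - 1)], each contributing [x i]. So a 1-factor remains exactly when the degree
   is odd. *)
have odd_beta : odd beta = odd (mu * (n - 1)).
  rewrite betaE -hx big_distrl /= !(big_morph odd oddD (erefl _)) big_mkcond.
  apply: eq_bigr => i _; rewrite -mulnA [RHS]oddM.
  by case: odd; rewrite ?andbT ?andbF.
have [||U' /mapP[j _ ->]|M []] := @decomposes_copies 'I_n _ mu_ r
  (fun i => seq_mset [seq T i j | j : 'I_(k i)]) copies [seq U j | j : 'I_(beta./2)].
- by move=> i _; apply: decomposes_of_admits (hT i).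
- by rewrite count_beta size_map -cardE card_ord.
- by rewrite card_ord.
rewrite count_beta !big_copies /=.
under eq_bigr do rewrite iterop_addn.
under [in X in decomposes _ X]eq_bigr do rewrite iterop_big_mset.
rewrite hx /leftover odd_beta => dM lM.
exact: (admits_of_decomposes (Ordinal n_gt0) reg dM lM).
Qed.
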